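(* Let $\Gamma$ be a finite tree. Let $1<d_1<d_2<\dots<d_m$ be the distinct degrees greater than $1$ occurring among the vertices of $\Gamma$, let $n_i$ be the number of vertices of $\Gamma$ of degree $d_i$ $(1\le i\le m)$, let $I=\sum_{i=1}^m n_i-1$, and let $E$ be the number of vertices of $\Gamma$ of degree $1$. Then the $\mathbb F_1$-zeta function of $\Gamma$ is $$\zeta^{\mathbb F_1}_\Gamma(t)=\frac{(t-1)^I}{t^{E+I}}\cdot\prod_{k=1}^m (t-d_k)^{-n_k}.$$
   Context: A tree is regarded as a loose graph (a loose graph is a set of vertices and edges with an incidence relation, each edge incident with at most two vertices; in a tree every edge has exactly two vertices). For a finite graph $\Gamma$ with vertex set $V$, and a field $k$, let $\mathbf P(\Gamma)_k$ be the projective space over $k$ with homogeneous coordinates $X_w$, $w\in V$. For $v\in V$ let $\mathbb A_v$ be the affine space of dimension $\deg(v)$ given by $X_v\neq0$ and $X_w=0$ for all $w\ne v$ not adjacent to $v$. $\mathcal F(\Gamma)$ is the associated Deitmar scheme ($\mathbb F_1$-scheme), and its base extension $\mathcal F(\Gamma)\otimes_{\mathbb F_1}k$ is the constructible subset $\bigcup_{v\in V}\mathbb A_v$ of $\mathbf P(\Gamma)_k$. There is a polynomial $P_\chi(X)=\sum_k a_kX^k\in\mathbb Z[X]$ such that for every finite field $\mathbb F_q$ the number of $\mathbb F_q$-rational points of $\mathcal F(\Gamma)\otimes_{\mathbb F_1}\mathbb F_q$ is $P_\chi(q)$. The $\mathbb F_1$-zeta function of $\Gamma$ is defined by $\zeta^{\mathbb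 F_1}_\Gamma(t):=\prod_{k}(t-k)^{-a_k}$.
   Formalization: The tree is assumed to have at least two vertices: for the one-vertex tree the zeta function is 1/t, while the stated formula (no degrees above 1, E = 0, I = -1) gives t/(t-1). *)

(* Defs.v *)
From HB Require Import structures.
From mathcomp Require Import all_boot all_order all_algebra.
From mathcomp Require boolp.

Set Implicit Arguments.
Unset Strict Implicit.
Unset Printing Implicit Defensive.

Import Order.TTheory GRing.Theory Num.Theory.

Local Open Scope ring_scope.

(* A finite graph given by its adjacency relation. Trees have no loops, no
   parallel edges and no edges with fewer than two vertices, so as a loose
   graph a tree is determined by such a relation. *)
Record graph := Graph {
  vertex :> finType;
  adj : rel vertex;
  adj_sym : symmetric adj;
  adj_irrefl : irreflexive adj }.

Definition deg (G : graph) (v : G) : nat := #|[set w | adj v w]|.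

Definition connected_graph (G : graph) : Prop :=
  forall v w : G, connect (@adj G) v w.

(* The bound on the size is needed: [:: v; w] with v, w adjacent satisfies
   ucycle, but only traverses one edge back and forth. *)
Definition acyclic_graph (G : graph) : Prop :=
  forall c : seq G, (2 < size c)%N -> ~ ucycle (@adj G) c.

Definition is_tree (G : graph) : Prop :=
  [/\ (0 < #|G|)%N, connected_graph G & acyclic_graph G].

Section RationalPoints.
Variables (G : graph) (k : finFieldType).

Definition scale (a : k) (x : {ffun G -> k}) : {ffun G -> k} :=
  [ffun w => a * x w].

(* The point with homogeneous coordinates x is the line of k^V spanned by x. *)
Definition proj_point (x : {ffun G -> k}) : {set {ffun G -> k}} :=
  [set scale a x | a : k].

Definition proj_space : {set {set {ffun G -> k}}} :=
  [set proj_point x | x : {ffun G -> k} & x != 0].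

Definition chart_coord (v : G) (x : {ffun G -> k}) : bool :=
  (x v != 0) && [forall w, (w != v) && ~~ adj v w ==> (x w == 0)].

Definition affine_chart (v : G) : {set {set {ffun G -> k}}} :=
  [set proj_point x | x : {ffun G -> k} & chart_coord v x].

(* The k-rational points of F(G) (x)_{F_1} k. *)
Definition F1_points : {set {set {ffun G -> k}}} :=
  \bigcup_(v : G) affine_chart v.

Lemma affine_chart_sub v : affine_chart v \subset proj_space.
Proof.
apply/subsetP => L /imsetP[x]; rewrite inE => /andP[xv _] ->.
apply/imsetP; exists x => //; rewrite inE.
by apply: contraNneq xv => ->; rewrite ffunE.
Qed.

Lemma F1_points_sub : F1_points \subset proj_space.
Proof. by apply/bigcupsP => v _; apply: affine_chart_sub. Qed.

End RationalPoints.

Definition counting_polynomial (G : graph) (P : {poly int}) : Prop :=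
  forall k : finFieldType, (#|F1_points G k|)%:Z = P.[(#|k|)%:Z].

Section CountingPolynomial.
Variable G : graph.

Definition good_support (S : {set G}) : bool :=
  [exists v, (v \in S) && [forall w, (w != v) && ~~ adj v w ==> (w \notin S)]].

Lemma card_support (k : finFieldType) (S : {set G}) :
  #|[set x : {ffun G -> k} | [set w | x w != 0] == S]| = (#|k|.-1 ^ #|S|)%N.
Proof.
rewrite -(cardC1 (0 : k)) -(card_pffun_on (0 : k) S (predC1 0)) -[RHS]cardsE.
congr #|pred_of_set _|; apply/setP => x; rewrite !inE.
apply/eqP/pffun_onP => [<-|[/supportP sx im]].
  split; first by apply/supportP => w; rewrite inE negbK => /eqP.
  by move=> y /imageP[w]; rewrite inE => xw ->.
apply/setP => w; rewrite inE.
have [wS|wS] := boolP (w \in S); last by rewrite sx ?eqxx.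
by apply: im; apply: image_f.
Qed.

Lemma card_fiber (k : finFieldType) (C : {set {ffun G -> k}}) (x : {ffun G -> k}) :
  x != 0 -> (forall a, a != 0 -> scale a x \in C) -> 
  #|[set y in C | (y != 0) && (proj_point y == proj_point x)]| = #|k|.-1.
Proof.
move=> x0 hC.
have inj : injective (fun a : k => scale a x).
  have [w xw] : exists w, x w != 0.
    apply/existsP; apply: contraNT x0; rewrite negb_exists => /forallP xw.
    by apply/eqP/ffunP => w; rewrite ffunE; apply/eqP; rewrite -[_ == _]negbK.
  by move=> a b /ffunP/(_ w); rewrite !ffunE => /(mulIf xw).
rewrite -(cardC1 (0 : k)) -(card_imset _ inj).
congr #|pred_of_set _|; apply/setP => y; rewrite !inE.
apply/and3P/imsetP => [[_ y0 /eqP yx]|[a]].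
  have : y \in proj_point x.
    by rewrite -yx; apply/imsetP; exists 1 => //; apply/ffunP => w; rewrite ffunE mul1r.
  case/imsetP => a _ ya; exists a => //; rewrite inE.
  by apply: contraNneq y0 => a0; rewrite ya a0; apply/eqP/ffunP => w; rewrite !ffunE mul0r.
rewrite inE => a0 ->; split; first exact: hC.
  apply: contraNneq x0 => /ffunP ax; apply/eqP/ffunP => w.
  by apply/(mulfI a0); have := ax w; rewrite !ffunE mulr0.
apply/eqP/setP => z; apply/imsetP/imsetP => -[b _ ->].
  by exists (b * a) => //; apply/ffunP => w; rewrite !ffunE mulrA.
by exists (b / a) => //; apply/ffunP => w; rewrite !ffunE mulrA mulfVK.
Qed.

Lemma card_F1_points (k : finFieldType) :
  (#|F1_points G k| * #|k|.-1 =
   \sum_(S : {set G} | good_support S) #|k|.-1 ^ #|S|)%N.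
Proof.
pose C := [set x : {ffun G -> k} | [exists v, chart_coord v x]].
have CE x : (x \in C) = good_support [set w | x w != 0].
  rewrite inE; apply: eq_existsb => v; rewrite /chart_coord inE.
  by congr andb; apply: eq_forallb => w; rewrite inE negbK.
have C0 x : x \in C -> x != 0.
  rewrite inE => /existsP[v /andP[xv _]].
  by apply: contraNneq xv => ->; rewrite ffunE.
have Cscale x a : x \in C -> a != 0 -> scale a x \in C.
  move=> xC a0; rewrite CE; move: xC; rewrite CE; congr good_support.
  by apply/setP => w; rewrite !inE ffunE mulf_eq0 (negPf a0).
have imC : F1_points G k = [set proj_point x | x in C].
  apply/setP => L; apply/bigcupP/imsetP.
    case=> v _ /imsetP[x]; rewrite inE => hx ->; exists x => //.
    by rewrite inE; apply/existsP; exists v.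
  case=> x; rewrite inE => /existsP[v hx] ->; exists v => //.
  by apply/imsetP; exists x; rewrite ?inE.
transitivity #|C|.
  rewrite -[RHS]sum1_card.
  rewrite (partition_big (@proj_point G k) (mem (F1_points G k))) /=; last first.
    by move=> x xC; rewrite imC imset_f.
  rewrite -sum_nat_const; apply: eq_bigr => L.
  rewrite imC => /imsetP[x xC ->].
  rewrite -(card_fiber (C0 x xC) (fun a => @Cscale x a xC)) -sum1_card.
  apply: eq_bigl => y; rewrite inE.
  by case yC : (y \in C) => //=; rewrite (C0 _ yC).
rewrite -[LHS]sum1_card.
rewrite (partition_big (fun x : {ffun G -> k} => [set w | x w != 0])
  good_support) /=; last by move=> x; rewrite CE.
apply: eq_bigr => S hS; rewrite -card_support -sum1_card.
apply: eq_bigl => x; rewrite CE inE.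
by apply: andb_idl => /eqP ->.
Qed.

Lemma counting_polynomial_exists : exists P, counting_polynomial G P.
Proof.
exists (\sum_(S : {set G} | good_support S) ('X - 1) ^+ #|S|.-1) => k.
have k1 : (1 < #|k|)%N by apply: card_finNzRing_gt1.
have k0 : (#|k|.-1)%:Z != 0 by rewrite -lt0n -subn1 subn_gt0.
apply: (mulIf k0); rewrite -PoszM card_F1_points horner_sum mulr_suml.
rewrite -natz natr_sum; apply: eq_bigr => S /existsP[v /andP[vS _]].
rewrite !hornerE (_ : (#|k|)%:Z - 1 = (#|k|.-1)%:Z); last first.
  by rewrite -subn1 -subzn ?(ltnW k1).
rewrite -exprSr prednK; last by apply/card_gt0P; exists v.
by rewrite natz -[in RHS]natz -natrX natz.
Qed.

Lemma counting_polynomial_unique P Q :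
  counting_polynomial G P -> counting_polynomial G Q -> P = Q.
Proof.
move=> hP hQ; apply/eqP; rewrite -subr_eq0; apply/eqP.
set D := P - Q.
have rD p : prime p -> root D p%:Z.
  move=> pp; rewrite /root hornerD hornerN.
  by rewrite -{1 2}(card_Fp pp) -hP -hQ subrr.
have [s [us ss ps]] : exists s : seq nat,
    [/\ uniq s, size s = size D & all prime s].
  elim: (size D) => [|n [s [us ss ps]]]; first by exists [::].
  have [p ltp pp] := prime_above (\max_(i <- s) i).
  exists (p :: s); split; rewrite /= ?ss ?us ?pp ?andbT //.
  apply/negP => ps'; move: ltp; rewrite ltnNge.
  by rewrite (@leq_bigmax_seq nat s xpredT (fun i => i) p).
apply: (@roots_geq_poly_eq0 _ D [seq p%:Z | p <- s]).
- by rewrite all_map; apply/allP => p /(allP ps) /rD.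
- by rewrite map_inj_uniq // => a b [].
- by rewrite size_map ss.
Qed.

End CountingPolynomial.

Definition P_chi (G : graph) : {poly int} :=
  sval (boolp.cid (counting_polynomial_exists G)).

Lemma P_chiP (G : graph) : counting_polynomial G (P_chi G).
Proof. exact: svalP. Qed.

(* The rational function t - a; the fraction field of Z[t] is Q(t). *)
Definition t_sub (a : nat) : {fraction {poly int}} :=
  tofrac ('X - (a%:Z)%:P).

Definition F1_zeta (G : graph) : {fraction {poly int}} :=
  \prod_(k < size (P_chi G)) t_sub k ^ (- (P_chi G)`_k).

(* Main.v *)
(** The points of F(Gamma) over F_q are counted by the supports S of their
    coordinate vectors: those S having a center, that is some v in S with S
    contained in the closed neighbourhood of v.  Summing over centers instead
    gives sum_v q^(deg v).  In a triangle-free graph a support has a single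
    center unless it is an edge, which has two, so the sum exceeds the number of
    points by q - 1 for each edge.  As a tree has |V| - 1 edges,
    P_chi = sum_v X^(deg v) - (|V| - 1) (X - 1), and the zeta function turns this
    sum into a product. *)
Require Import Defs.
From mathcomp Require Import all_boot all_order all_algebra.

Set Implicit Arguments.
Unset Strict Implicit.
Unset Printing Implicit Defensive.

Import Order.TTheory GRing.Theory Num.Theory.

Local Open Scope ring_scope.

(** * Edges of a tree and their number *)

Section Edges.
Variable G : graph.

(** Edges are unordered vertex sets, so that each is counted once and can be compared with a
    support. *)
Definition edges : {set {set G}} :=
  [set [set p.1; p.2] | p : G * G & adj p.1 p.2].

Lemma edgesP (S : {set G}) :
  reflect (exists u v, adj u v /\ S = [set u; v]) (S \in edges).
Proof.
apply: (iffP imsetP) => [[[u v]]|[u [v [uv ->]]]].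
  by rewrite inE /= => uv ->; exists u, v.
by exists (u, v); rewrite ?inE.
Qed.

Lemma adj_neq (u v : G) : adj u v -> u != v.
Proof. by apply: contraTneq => ->; rewrite adj_irrefl. Qed.

Lemma card_edge (S : {set G}) : S \in edges -> #|S| = 2.
Proof. by case/edgesP => u [v [/adj_neq uv ->]]; rewrite cards2 uv. Qed.

Lemma acyclic_no_triangle (u v w : G) :
  acyclic_graph G -> adj u v -> adj v w -> adj w u -> False.
Proof.
move=> acG uv vw wu; apply: (acG [:: u; v; w]) => //.
rewrite /ucycle /= uv vw wu !inE negb_or !(adj_neq uv) (adj_neq vw).
by rewrite eq_sym (adj_neq wu).
Qed.

(** Walks are tuples of a fixed length, which makes existence decidable and lets [ex_minn] produce
    the distance from [r]. *)
Definition reachable_in (r v : G) (l : nat) : bool :=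
  [exists t : l.-tuple G, path (@adj G) r t && (last r t == v)].

(** Take for [rank] the distance from [r]; the last vertex but one on a shortest walk from [r] to
    [v] is a neighbour of smaller rank. The parents describe a spanning tree rooted at [r]. *)
Lemma connected_parent (r : G) : connected_graph G ->
  exists (par : G -> G) (rank : G -> nat),
    forall v, v != r -> adj v (par v) /\ (rank (par v) < rank v)%N.
Proof.
move=> conG.
have ex v : exists l, reachable_in r v l.
  have /connectP[p pp ->] := conG r v.
  by exists (size p); apply/existsP; exists (in_tuple p); rewrite pp /=.
pose rank v := ex_minn (ex v).
have step v : v != r -> exists u, adj v u && (rank u < rank v)%N.
  move=> vr; rewrite {2}/rank; case: ex_minnP => l /existsP[t /andP[]].
  case: t => t /= /eqP <-; case/lastP: t => [|t x] /=.
    by move=> _ /eqP rv; rewrite rv eqxx in vr.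
  rewrite rcons_path last_rcons => /andP[pt tx] /eqP <- _.
  exists (last r t); rewrite adj_sym tx size_rcons ltnS /rank.
  case: ex_minnP => l' _; apply.
  by apply/existsP; exists (in_tuple t); rewrite pt /=.
(* The default value [v] is returned only at the root. *)
exists (fun v => odflt v [pick u | adj v u && (rank u < rank v)%N]), rank.
move=> v /step[u hu]; case: pickP => [w /andP[]|/(_ u)] //.
by rewrite hu.
Qed.

(** Sending each [v != r] to the edge joining it to its parent is a bijection onto the edges. *)
Lemma card_tree_edges : is_tree G -> #|edges| = #|G|.-1.
Proof.
case=> G0 conG acG; have [r _] : exists r : G, r \in G by apply/card_gt0P.
have [par [rank parP]] := connected_parent r conG.
pose pedge v := [set v; par v].
pose T : rel G :=
  fun u v => (u != r) && (par u == v) || (v != r) && (par v == u).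
have subT : subrel T (@adj G).
  move=> u v /orP[] /andP[/parP[a _] /eqP <-] //.
  by rewrite adj_sym.
have conT u : connect T u r.
  have [l] := ubnP (rank u); elim: l u => // l IH u.
  rewrite ltnS => ul; have [->|ur] := eqVneq u r; first exact: connect0.
  have [_ lt] := parP u ur.
  apply: connect_trans (IH _ (leq_trans lt ul)).
  by apply: connect1; rewrite /T ur eqxx.
have symT : symmetric T by move=> u v; rewrite /T orbC.
(* An edge outside the spanning tree T closes a path of T into a cycle. *)
have adjT u v : adj u v -> T u v.
  move=> uv; apply/idPn => nT.
  have /connectP[p0 pp0 lp0] : connect T u v.
    apply: connect_trans (conT u) _.
    by rewrite (sym_connect_sym symT); apply: conT.
  case/shortenP: pp0 lp0 => p pp up _ vp.
  apply: (acG (u :: p)).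
    (* A path of length 0 would give [u = v], and one of length 1 would give [T u v]; so the cycle
       has at least three vertices. *)
    case: p pp vp {up} => [|x [|y p]] //=.
      by move=> _ vu; rewrite vu adj_irrefl in uv.
    by move=> /andP[ux _] vx; rewrite vx ux in nT.
  by rewrite /ucycle up /= rcons_path (sub_path subT pp) -vp adj_sym uv.
have -> : edges = pedge @: [set~ r].
  apply/setP => S; apply/edgesP/imsetP => [[u [v [/adjT uv ->]]]|[v]].
    case/orP: uv => /andP[xr /eqP <-]; [exists u|exists v]; rewrite ?inE //.
    by rewrite setUC.
  by rewrite !inE => /parP[a _] ->; exists v, (par v).
rewrite card_in_imset; first by rewrite cardsC1.
(* Distinct vertices with the same parent edge would be each other's parents, each of smaller rank
   than the other. *)
move=> u v; rewrite !inE => ur vr /setP uv; apply/eqP/idPn => nuv.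
have := uv u; rewrite !inE eqxx (negPf nuv) /= => /esym/eqP upv.
have := uv v; rewrite !inE eqxx eq_sym (negPf nuv) /= => /eqP vpu.
have [_] := parP u ur; have [_] := parP v vr.
by rewrite -upv -vpu => lt1 /(ltn_trans lt1); rewrite ltnn.
Qed.

End Edges.

(** * Counting supports through their centers *)

Section Centers.
Variable G : graph.
Implicit Types (S : {set G}) (v w : G).

(** This is the condition under the quantifier of [good_support], so the two match by conversion. *)
Definition is_center S v : bool :=
  (v \in S) && [forall w, (w != v) && ~~ adj v w ==> (w \notin S)].

Lemma is_centerP S v :
  reflect (v \in S /\ forall w, w \in S -> w != v -> adj v w) (is_center S v).
Proof.
apply: (iffP andP) => -[vS h]; split=> //.
  move=> w wS wv; apply/idPn => nvw.
  by move/forallP/(_ w): h; rewrite wv nvw wS.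
apply/forallP => w; apply/implyP => /andP[wv].
by apply: contra => wS; apply: h.
Qed.

(** The binomial theorem: each element of [N] is either left out, with weight 1, or taken, with
    weight [b]. *)
Lemma sum_subset_expn (T : finType) (N : {set T}) (b : nat) :
  (\sum_(A : {set T} | A \subset N) b ^ #|A| = b.+1 ^ #|N|)%N.
Proof.
have [l] := ubnP #|N|; elim: l N => // l IH N; rewrite ltnS => Nl.
have [->|[x xN]] := set_0Vmem N.
  rewrite cards0 expn0 (big_pred1 set0) ?cards0 //.
  by move=> A; rewrite subset0.
have cN := cardsD1 x N; rewrite xN in cN.
have {}IH := IH (N :\ x) _; rewrite cN add1n expnS -IH; last first.
  by move: Nl; rewrite cN add1n.
rewrite (bigID (fun A : {set T} => x \in A)) /= addnC mulSn; congr addn.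
  by apply: eq_bigl => A; rewrite subsetD1.
rewrite (reindex_onto (fun A => x |: A) (fun A => A :\ x)) /=; last first.
  by move=> A /andP[_ xA]; rewrite setD1K.
rewrite big_distrr /=; apply: eq_big => [A|A /andP[_ /eqP xA]].
  rewrite setU11 andbT subUset sub1set xN /= subsetD1.
  have [xA|xA] := boolP (x \in A); last by rewrite setU1K ?eqxx.
  rewrite andbF; apply/negP => /andP[_ /eqP h].
  by move: xA; rewrite -h !inE eqxx.
by rewrite -expnS cardsU1 -{1}xA !inE eqxx.
Qed.

(** A support centered at [v] is [v] together with an arbitrary set of neighbours of [v]. *)
Lemma sum_centered_expn v (b : nat) :
  (\sum_(S : {set G} | is_center S v) b ^ #|S| = b * b.+1 ^ deg v)%N.
Proof.
rewrite -sum_subset_expn big_distrr /=.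
rewrite (reindex_onto (fun A => v |: A) (fun A => A :\ v)) /=; last first.
  by move=> A /andP[vA _]; rewrite setD1K.
apply: eq_big => [A|A /andP[_ /eqP vA]].
  apply/andP/subsetP => [[/is_centerP[_ h] /eqP vA] w wA|h].
    rewrite inE; apply: h; first by rewrite inE wA orbT.
    by apply: contraTneq wA => ->; rewrite -vA !inE eqxx.
  have vA : v \notin A by apply/negP => /h; rewrite inE adj_irrefl.
  split; last by rewrite setU1K.
  apply/is_centerP; split; first exact: setU11.
  by move=> w /setU1P[->|/h]; rewrite ?eqxx // inE.
by rewrite -expnS cardsU1 -{1}vA !inE eqxx.
Qed.

(** Two distinct centers are adjacent, and a third vertex of [S] would form a triangle with them;
    hence [S] is an edge, and both ends of an edge are centers of it. *)
Lemma card_centers S : acyclic_graph G ->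
  #|[set v | is_center S v]| = (good_support S + (S \in edges G))%N.
Proof.
move=> acG; have [/edgesP[u [v [uv ->]]]|nE] := boolP (S \in edges G).
  have -> : [set w | is_center [set u; v] w] = [set u; v].
    apply/setP => w; rewrite inE; apply/is_centerP/idP => [[]//|wS]; split=> //.
    by move=> x /set2P[]->; case/set2P: wS => ->; rewrite ?eqxx // adj_sym.
  rewrite cards2 (adj_neq uv).
  suff -> : good_support [set u; v] by [].
  apply/existsP; exists u; apply/is_centerP; split; first exact: set21.
  by move=> x /set2P[]->; rewrite ?eqxx.
rewrite addn0; have [/existsP[v vc]|ng] := boolP (good_support S).
  rewrite (_ : [set _ | _] = [set v]) ?cards1 //.
  apply/setP => w; rewrite !inE; apply/idP/eqP => [wc|-> //].
  apply/eqP; apply: contraNT nE => wv.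
  have [vS vh] := is_centerP _ _ vc; have [wS wh] := is_centerP _ _ wc.
  have vw := vh w wS wv; apply/edgesP; exists v, w; split=> //.
  apply/setP => x; rewrite !inE; apply/idP/orP => [xS|[] /eqP -> //].
  have [_|xv] := eqVneq x v; first by left.
  have [_|xw] := eqVneq x w; first by right.
  case: (acyclic_no_triangle acG vw (wh x xS xw)).
  by rewrite adj_sym vh.
apply/eqP; rewrite cards_eq0; apply: contraNT ng => /set0Pn[v].
by rewrite inE => vc; apply/existsP; exists v.
Qed.

(** Double counting of pairs of a support and a center, to be used with [b] equal to q - 1. The edge
    term stands on the left to avoid subtraction of naturals. *)
Lemma sum_good_support (b : nat) : acyclic_graph G ->
  (\sum_(S : {set G} | good_support S) b ^ #|S| + #|edges G| * b ^ 2 =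
   \sum_(v : G) b * b.+1 ^ deg v)%N.
Proof.
move=> acG; under [RHS]eq_bigr => v _ do rewrite -sum_centered_expn.
rewrite (exchange_big_dep xpredT) //=.
transitivity (\sum_(S : {set G})
    (good_support S + (S \in edges G)) * b ^ #|S|)%N; last first.
  apply: eq_bigr => S _; rewrite -card_centers // -sum_nat_const.
  by apply: eq_bigl => v; rewrite inE.
under [RHS]eq_bigr => S _ do rewrite mulnDl.
rewrite big_split /=; congr addn.
  by rewrite big_mkcond; apply: eq_bigr => S _; case: good_support; rewrite ?mul1n.
rewrite -sum_nat_const big_mkcond; apply: eq_bigr => S _.
by case: ifP => [/card_edge->|]; rewrite ?mul1n.
Qed.

End Centers.

(** * The counting polynomial of a tree *)

Lemma P_chi_tree (G : graph) : is_tree G ->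
  P_chi G = \sum_(v : G) 'X^(deg v) - ('X - 1) *+ #|G|.-1.
Proof.
move=> treeG; have [_ _ acG] := treeG.
apply: counting_polynomial_unique (P_chiP G) _ => k.
have k1 : (1 < #|k|)%N by apply: card_finNzRing_gt1.
have kE : #|k| = #|k|.-1.+1 by rewrite prednK // ltnW.
have b0 : (#|k|.-1)%:Z != 0 by rewrite -lt0n -subn1 subn_gt0.
(* Multiplying by q - 1 passes from points to coordinate vectors, which are counted by support. *)
apply: (mulIf b0); rewrite -PoszM card_F1_points.
have := sum_good_support #|k|.-1 acG; rewrite card_tree_edges // -kE.
move/(congr1 Posz); rewrite PoszD => /(canRL (addrK _)) ->.
rewrite hornerD hornerN hornerMn horner_sum hornerD hornerN hornerX hornerC.
rewrite mulrBl mulr_suml; congr (_ - _).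
  rewrite -natz natr_sum; apply: eq_bigr => v _.
  by rewrite natz hornerXn PoszM mulrC -natz natrX natz.
rewrite (_ : (#|k|)%:Z - 1 = (#|k|.-1)%:Z); last first.
  by rewrite -subn1 -subzn // ltnW.
by rewrite -mulr_natl natz -mulrA -!PoszM mulnn.
Qed.

(** * The zeta product turns sums of polynomials into products *)

Lemma t_sub_neq0 (a : nat) : t_sub a != 0.
Proof. by rewrite tofrac_eq0 polyXsubC_eq0. Qed.

(** The product defining [F1_zeta], for any polynomial, so that additivity can be stated. *)
Definition zeta_of (P : {poly int}) : {fraction {poly int}} :=
  \prod_(k < size P) t_sub k ^ (- P`_k).

(** Coefficients beyond the size vanish and give factors 1; polynomials of different sizes can thus
    share one index range. *)
Lemma zeta_of_widen (N : nat) (P : {poly int}) : (size P <= N)%N ->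
  zeta_of P = \prod_(k < N) t_sub k ^ (- P`_k).
Proof.
move=> PN; rewrite /zeta_of (big_ord_widen N (fun k => t_sub k ^ (- P`_k))) //.
rewrite big_mkcond; apply: eq_bigr => k _; case: ltnP => // kP.
by rewrite nth_default // oppr0 expr0z.
Qed.

Lemma zeta_of0 : zeta_of 0 = 1.
Proof. by rewrite /zeta_of size_poly0 big_ord0. Qed.

Lemma zeta_ofD (P Q : {poly int}) : zeta_of (P + Q) = zeta_of P * zeta_of Q.
Proof.
pose N := maxn (size P) (size Q).
rewrite (@zeta_of_widen N (P + Q)) ?size_polyD //.
rewrite (@zeta_of_widen N P) ?leq_maxl // (@zeta_of_widen N Q) ?leq_maxr //.
rewrite -big_split /=; apply: eq_bigr => k _.
by rewrite coefD opprD expfzDr // t_sub_neq0.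
Qed.

Lemma zeta_of_neq0 (P : {poly int}) : zeta_of P != 0.
Proof. by apply/prodf_neq0 => k _; rewrite expfz_neq0 // t_sub_neq0. Qed.

Lemma zeta_ofN (P : {poly int}) : zeta_of (- P) = (zeta_of P)^-1.
Proof.
apply: (mulIf (zeta_of_neq0 P)).
by rewrite -zeta_ofD addNr zeta_of0 mulVf // zeta_of_neq0.
Qed.

Lemma zeta_ofMn (P : {poly int}) (n : nat) : zeta_of (P *+ n) = zeta_of P ^+ n.
Proof.
by elim: n => [|n IH]; rewrite ?zeta_of0 // mulrS zeta_ofD IH exprS.
Qed.

Lemma zeta_of_Xn (n : nat) : zeta_of 'X^n = (t_sub n)^-1.
Proof.
rewrite /zeta_of size_polyXn big_ord_recr /= coefXn eqxx big1 ?mul1r //.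
by move=> i _; rewrite coefXn ltn_eqF // oppr0 expr0z.
Qed.

Lemma F1_zeta_tree (G : graph) : is_tree G ->
  F1_zeta G =
    \prod_(v : G) (t_sub (deg v))^-1 * (t_sub 1 / t_sub 0) ^+ #|G|.-1.
Proof.
move=> treeG; rewrite /F1_zeta -/(zeta_of _) P_chi_tree //.
rewrite zeta_ofD zeta_ofN zeta_ofMn (big_morph _ zeta_ofD zeta_of0).
under eq_bigr => v _ do rewrite zeta_of_Xn.
(* Each subtracted copy of X - 1, read as X^1 - X^0, contributes (t - 1)/t. *)
congr (_ * _); rewrite -exprVn (_ : 'X - 1 = 'X^1 - 'X^0) //.
by rewrite zeta_ofD zeta_ofN !zeta_of_Xn invfM !invrK.
Qed.

(** * Grouping the vertices by degree *)

Lemma connected_deg_gt0 (G : graph) (v : G) :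
  connected_graph G -> (1 < #|G|)%N -> (0 < deg v)%N.
Proof.
move=> conG; rewrite -cardsT (cardsD1 v) inE ltnS => /card_gt0P[w].
rewrite !inE andbT => wv; have /connectP[[|x p] /=] := conG v w.
  by move=> _ wE; rewrite wE eqxx in wv.
by move=> /andP[vx _] _; apply/card_gt0P; exists x; rewrite inE.
Qed.

(** [d] lists the degrees above 1 without repetition, so its fibers partition these vertices. The
    operation is general because both the vertex count and the zeta product are split this way. *)
Lemma big_deg_gt1 (R : Type) (idx : R) (op : Monoid.com_law idx) (G : graph)
    (m : nat) (d : 'I_m -> nat) (F : G -> R) :
  injective d ->
  (forall e : nat,
     (exists i : 'I_m, d i = e) <-> (1 < e)%N /\ (exists v : G, deg v = e)) ->
  \big[op/idx]_(v | (1 < deg v)%N) F v =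
    \big[op/idx]_(i < m) \big[op/idx]_(v | deg v == d i) F v.
Proof.
move=> d_inj d_deg; rewrite (exchange_big_dep (fun v => 1 < deg v)%N) /=.
  apply: eq_bigr => v v1.
  have [i di] : exists i, d i = deg v by apply/d_deg; split=> //; exists v.
  rewrite (big_pred1 i) // => j; rewrite -di /= eq_sym.
  exact: inj_eq.
move=> i v _ /eqP ->.
by have [] : (1 < d i)%N /\ (exists v : G, deg v = d i) by apply/d_deg; exists i.
Qed.

Theorem mainTheorem2 (G : graph) (hG : is_tree G) (hG2 : (1 < #|G|)%N)
    (m : nat) (d : 'I_m -> nat)
    (d_incr : forall i j : 'I_m, (i < j)%N -> (d i < d j)%N)
    (d_deg : forall e : nat,
       (exists i : 'I_m, d i = e) <-> (1 < e)%N /\ (exists v : G, deg v = e))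
    (n : 'I_m -> nat)
    (hn : forall i : 'I_m, n i = #|[set v : G | deg v == d i]|)
    (I : int) (hI : I = \sum_(i < m) (n i)%:Z - 1)
    (E : nat) (hE : E = #|[set v : G | deg v == 1%N]|) :
  F1_zeta G =
    t_sub 1 ^ I / t_sub 0 ^ (E%:Z + I)
    * \prod_(k < m) t_sub (d k) ^ (- (n k)%:Z).
Proof.
have [_ conG _] := hG.
have d_inj : injective d.
  move=> i j dij; apply: val_inj; have [||//] := ltngtP i j => /d_incr.
    by rewrite dij ltnn.
  by rewrite dij ltnn.
have deg1 (v : G) : ~~ (deg v == 1%N) = (1 < deg v)%N.
  by have := connected_deg_gt0 v conG hG2; case: (deg v) => [|[]].
have cardG : (#|G| = E + \sum_(i < m) n i)%N.
  rewrite -sum1_card (bigID (fun v => deg v == 1%N)) /=; congr addn.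
    by rewrite hE -sum1_card; apply: eq_bigl => v; rewrite inE.
  rewrite (eq_bigl _ _ deg1) (big_deg_gt1 _ _ d_inj d_deg).
  apply: eq_bigr => i _; rewrite hn -sum1_card.
  by apply: eq_bigl => v; rewrite inE.
(* The number of edges, which is the exponent of (t - 1)/t, in terms of [E] and [I]. *)
have EI : (#|G|.-1)%:Z = E%:Z + I.
  rewrite hI addrA -subn1 -subzn ?(ltnW hG2) // cardG PoszD; congr (_ + _ - _).
  by rewrite -natz natr_sum; apply: eq_bigr => i _; rewrite natz.
have prod_deg (e c : nat) : c = #|[set v : G | deg v == e]| ->
    \prod_(v : G | deg v == e) (t_sub (deg v))^-1 = t_sub e ^ (- c%:Z).
  move=> ->; rewrite (eq_bigr (fun=> (t_sub e)^-1)) => [|v /eqP-> //].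
  by rewrite prodr_const exprnP exprz_inv cardsE.
rewrite F1_zeta_tree // (bigID (fun v => deg v == 1%N)) /=.
rewrite (eq_bigl _ _ deg1) (big_deg_gt1 _ _ d_inj d_deg) /=.
rewrite (prod_deg _ _ hE).
under eq_bigr => i _ do rewrite (prod_deg _ _ (hn i)).
(* The leaves contribute (t - 1)^(-E), which lowers the exponent E + I of t - 1 to I; the exponent
   of t stays. *)
rewrite mulrAC exprnP EI expfzMl exprz_inv mulrA -expfzDr ?t_sub_neq0 //.
by rewrite addKr -invr_expz.
Qed.
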